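(* Let $\mathsf{G}$ be a complete convex geometric graph of order $n\neq 4$. Then $\alpha_1(\mathsf{G})\ge \left\lfloor \frac{n^2+n}{4}\right\rfloor$.
   Context: A complete convex geometric graph of order $n$ is the complete geometric graph (all $\binom n2$ straight-line segments) on $n$ points in convex position. Two edges intersect if they share an endpoint or cross; otherwise they are disjoint. An edge coloring with $k$ colors is a surjective map from the edge set onto $\{1,\dots,k\}$. It is proper if any two edges of the same color are disjoint, and complete if for every pair of distinct colors there is an edge of the first color and an edge of the second color that intersect. $\alpha_1(\mathsf{G})$ is the largest $k$ for which a proper and complete edge coloring of $\mathsf{G}$ with $k$ colors exists. *)

(* Defs.v *)
From mathcomp Require Import all_boot all_order all_algebra.
From mathcomp Require Import boolp classical_sets reals convex.

Set Implicit Arguments.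
Unset Strict Implicit.
Unset Printing Implicit Defensive.

Import Order.TTheory GRing.Theory Num.Theory.
Local Open Scope classical_set_scope.
Local Open Scope ring_scope.

(* No point lies in the convex hull of the others; this makes p injective and
   forbids three collinear points. *)
Definition convex_position (R : realType) (n : nat) (p : 'I_n -> 'rV[R]_2)
    : Prop :=
  forall i : 'I_n,
    ~ smallest (@convex_set R 'rV[R]_2) (p @` [set j | j != i]) (p i).

(* An edge of the complete geometric graph on the points p is named by the
   labels of its two endpoints. *)
Definition edge (n : nat) := {e : {set 'I_n} | #|e| == 2%N}.

Definition open_segment (R : realType) (n : nat) (p : 'I_n -> 'rV[R]_2)
    (e : edge n) : set 'rV[R]_2 :=
  [set q | exists (i j : 'I_n) (t : R),
    [/\ val e = [set i; j]%SET, 0 < t < 1 & q = t *: p i + (1 - t) *: p j]].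

Definition share_endpoint (n : nat) (e f : edge n) : Prop :=
  exists i : 'I_n, i \in val e /\ i \in val f.

Definition cross (R : realType) (n : nat) (p : 'I_n -> 'rV[R]_2)
    (e f : edge n) : Prop :=
  open_segment p e `&` open_segment p f !=set0.

Definition intersect (R : realType) (n : nat) (p : 'I_n -> 'rV[R]_2)
    (e f : edge n) : Prop :=
  share_endpoint e f \/ cross p e f.

Definition surjective_coloring (n k : nat) (c : edge n -> 'I_k) : Prop :=
  forall a : 'I_k, exists e : edge n, c e = a.

Definition proper_coloring (R : realType) (n : nat) (p : 'I_n -> 'rV[R]_2)
    (k : nat) (c : edge n -> 'I_k) : Prop :=
  forall e f : edge n, e != f -> c e = c f -> ~ intersect p e f.

Definition complete_coloring (R : realType) (n : nat) (p : 'I_n -> 'rV[R]_2)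
    (k : nat) (c : edge n -> 'I_k) : Prop :=
  forall a b : 'I_k, a != b ->
    exists e f : edge n, [/\ c e = a, c f = b & intersect p e f].

Definition proper_complete_colorable (R : realType) (n : nat)
    (p : 'I_n -> 'rV[R]_2) (k : nat) : Prop :=
  exists c : edge n -> 'I_k,
    [/\ surjective_coloring c, proper_coloring p c & complete_coloring p c].

(* By surjectivity k is at most the number of edges, so the range of the
   maximum loses nothing; see alpha1_max. *)
Definition alpha1 (R : realType) (n : nat) (p : 'I_n -> 'rV[R]_2) : nat :=
  \max_(k < #|{: edge n}|.+1 | `[< proper_complete_colorable p k >]) k.

Lemma surjective_coloring_leq (n k : nat) (c : edge n -> 'I_k) :
  surjective_coloring c -> (k <= #|{: edge n}|)%N.
Proof.
move=> cS; have [g gK] := choice cS.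
by rewrite -[k in (k <= _)%N]card_ord; apply: (leq_card g); apply: can_inj gK.
Qed.

(* A surjective proper coloring with the fewest colors is complete, since two
   colors witnessing the contrary could be merged. *)
Lemma proper_complete_colorable_exists (R : realType) (n : nat)
    (p : 'I_n -> 'rV[R]_2) : exists k, proper_complete_colorable p k.
Proof.
pose P k := `[< exists c : edge n -> 'I_k,
  surjective_coloring c /\ proper_coloring p c >].
have exP : exists k, P k.
  exists #|{: edge n}|; apply/asboolP; exists enum_rank; split.
    by move=> a; exists (enum_val a); rewrite enum_valK.
  by move=> e f /eqP ef /enum_rank_inj.
case: (ex_minnP exP) => k /asboolP[c [cS cP]] kmin.
exists k, c; split=> // a b ab; apply: contrapT => nab.
case: k => [|k] in c cS cP kmin a b ab nab *; first by case: a ab nab.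
have [a' a'E] : exists a', a = lift b a'.
  by case: (unliftP b a) ab => [a' ->|->]; [exists a'|rewrite eqxx].
pose c' e := odflt a' (unlift b (c e)).
suff /kmin : P k by rewrite ltnn.
apply/asboolP; exists c'; split=> [x|e f ef].
  by have [e eE] := cS (lift b x); exists e; rewrite /c' eE liftK.
rewrite /c'.
case: (unliftP b (c e)) => [x|] eE; case: (unliftP b (c f)) => [y|] fE /= xy.
- by apply: cP => //; rewrite eE fE xy.
- move=> ief; apply: nab; exists e, f; split=> //.
  by rewrite eE xy a'E.
- move=> ief; apply: nab; exists f, e; split=> //.
    by rewrite fE -xy a'E.
  case: ief => [[i [ie jf]]|[q [qe qf]]]; first by left; exists i.
  by right; exists q.
- by apply: cP => //; rewrite eE fE.
Qed.

Lemma alpha1_max (R : realType) (n : nat) (p : 'I_n -> 'rV[R]_2) :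
  proper_complete_colorable p (alpha1 p) /\
  forall k, proper_complete_colorable p k -> (k <= alpha1 p)%N.
Proof.
have bnd k : proper_complete_colorable p k -> (k < #|{: edge n}|.+1)%N.
  by move=> [c [cS _ _]]; rewrite ltnS; apply: surjective_coloring_leq cS.
split=> [|k kP]; last first.
  by apply: (@leq_bigmax_cond _ _ _ (Ordinal (bnd k kP))); apply/asboolP.
have [k kP] := proper_complete_colorable_exists p.
rewrite /alpha1 (@bigop.bigmax_eq_arg _ (Ordinal (bnd k kP))); last exact/asboolP.
by case: arg_maxnP => [|i /asboolP //]; apply/asboolP.
Qed.

(* Main.v *)
Require Import Defs.
From mathcomp Require Import all_boot all_order all_algebra.
From mathcomp Require Import reals.
From mathcomp Require Import boolp classical_sets interval_inference convex.
From mathcomp Require Import zify ring lra.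

(* Label the points 0, ..., n-1 in convex cyclic order and put h = n/2 (rounded
   down). A family of pairwise intersecting classes, each a single edge or two
   disjoint edges, extends to a proper and complete coloring: among the proper
   colorings constant on the classes, one with the fewest colors is complete. So
   it suffices to find (n^2+n)/4 such classes.

   The single edges are n longest edges, pairwise intersecting. The other classes
   are zigzags: an edge spanning s consecutive points followed by an edge spanning
   the next u points, where s, u <= h < s + u. A zigzag with the short side
   joining its two edges cuts the remaining points into three arcs of at most h
   points, and a class missing it would lie within one of them; by length, it
   cannot. What remains is to match nearly all short edges in this way, and the
   matching depends on n modulo 4. *)
Set Implicit Arguments.
Unset Strict Implicit.
Unset Printing Implicit Defensive.

Import Order.TTheory GRing.Theory Num.Theory.
Local Open Scope ring_scope.

(** * Orientation and cyclic order *)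

(** Twice the signed area of the triangle [x y z], positive when it runs counterclockwise. *)
Definition orient (R : realType) (x y z : 'rV[R]_2) : R :=
  (y 0 0 - x 0 0) * (z 0 1 - x 0 1) - (y 0 1 - x 0 1) * (z 0 0 - x 0 0).

Lemma orient_cycle (R : realType) (x y z : 'rV[R]_2) :
  orient y z x = orient x y z.
Proof. by rewrite /orient; ring. Qed.

Lemma orient_flip (R : realType) (x y z : 'rV[R]_2) :
  orient x z y = - orient x y z.
Proof. by rewrite /orient; ring. Qed.

(** Both sides are twice the signed area of the quadrilateral [x y z w], cut along one diagonal or
    the other. *)
Lemma orientD (R : realType) (x y z w : 'rV[R]_2) :
  orient x y z + orient x z w = orient x y w + orient y z w.
Proof. by rewrite /orient; ring. Qed.

Lemma rV2P (R : realType) (x y : 'rV[R]_2) :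
  x 0 0 = y 0 0 -> x 0 1 = y 0 1 -> x = y.
Proof.
move=> e0 e1; apply/rowP => -[[|[|//]] ilt].
  by rewrite (_ : Ordinal ilt = 0) //; apply: val_inj.
by rewrite (_ : Ordinal ilt = 1) //; apply: val_inj.
Qed.

(** The weights are normalized here, so that signed areas can later serve as weights. *)
Lemma convex_set_comb (R : realType) (A : set 'rV[R]_2) (x y : 'rV[R]_2)
    (a b : R) :
  convex_set A -> A x -> A y -> 0 <= a -> 0 <= b -> 0 < a + b ->
  A ((a / (a + b)) *: x + (b / (a + b)) *: y).
Proof.
move=> Ac Ax Ay a0 b0 ab.
have t0 : 0 <= a / (a + b) by rewrite divr_ge0 // ltW.
have t1 : a / (a + b) <= 1 by rewrite ler_pdivrMr // mul1r lerDl.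
have := Ac x y (Itv01 t0 t1).
rewrite !inE => /(_ Ax Ay).
congr (A _); congr (_ + _ *: _) => /=.
by rewrite [LHS](_ : _ = 1 - a / (a + b)) //; field; lra.
Qed.

(** The points [j], [k], [l] may coincide, so this also excludes a point lying on the segment
    between two others. *)
Lemma convex_position_comb (R : realType) (n : nat) (p : 'I_n -> 'rV[R]_2)
    (i j k l : 'I_n) (a b c : R) :
  convex_position p -> j != i -> k != i -> l != i ->
  0 <= a -> 0 <= b -> 0 <= c -> 0 < a + b ->
  (a + b + c) *: p i <> a *: p j + b *: p k + c *: p l.
Proof.
move=> hp ji ki li a0 b0 c0 ab E; apply: (hp i) => A [Ac /= Asub].
have Ap m : m != i -> A (p m) by move=> mi; apply: Asub; exists m.
have Ajk := convex_set_comb Ac (Ap j ji) (Ap k ki) a0 b0 ab.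
have abc : 0 < a + b + c by lra.
have := convex_set_comb Ac Ajk (Ap l li) (ltW ab) c0 abc.
congr (A _); apply: (scalerI (lt0r_neq0 abc)); rewrite E.
rewrite !scalerDr !scalerA; congr (_ *: _ + _ *: _ + _ *: _); field; lra.
Qed.

(** If the points were collinear, [p k] would have a parameter [t] on the line from [p i] to [p j].
    The cases [t < 0], [0 < t < 1] and [1 < t] put [p i], [p k] and [p j], respectively, between the
    other two. *)
Lemma orient_neq0 (R : realType) (n : nat) (p : 'I_n -> 'rV[R]_2)
    (i j k : 'I_n) :
  convex_position p -> i != j -> i != k -> j != k ->
  orient (p i) (p j) (p k) != 0.
Proof.
move=> hp ij ik jk; apply/eqP => o0.
have btw (x y z : 'I_n) (t : R) : y != x -> z != x -> 0 < t < 1 ->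
    p x <> t *: p y + (1 - t) *: p z.
  move=> yx zx /andP[t0 t1] E.
  have t1' : 0 <= 1 - t by lra.
  have s0 : 0 < t + (1 - t) by lra.
  apply: (convex_position_comb hp yx zx zx (ltW t0) t1' (lexx 0) s0).
  by rewrite scale0r !addr0 addrC subrK scale1r.
have neq (x y : 'I_n) : x != y -> p x <> p y.
  move=> xy E; apply: (btw x y y (1 / 2)); rewrite 1?eq_sym //; first lra.
  by rewrite -scalerDl addrC subrK scale1r.
have [t tE] : exists t, p k = p i + t *: (p j - p i).
  have [d0|d0] := eqVneq (p j 0 0 - p i 0 0) 0.
    have d1 : p j 0 1 - p i 0 1 != 0.
      by apply/eqP => d1; apply: (neq i j ij); apply: rV2P; lra.
    exists ((p k 0 1 - p i 0 1) / (p j 0 1 - p i 0 1)).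
    apply: rV2P; rewrite !mxE; last by field.
    move: o0; rewrite /orient d0 mul0r sub0r mulr0 addr0 => /eqP.
    rewrite oppr_eq0 mulf_eq0 (negPf d1) /= subr_eq0 => /eqP ->; lra.
  exists ((p k 0 0 - p i 0 0) / (p j 0 0 - p i 0 0)).
  apply: rV2P; rewrite !mxE; first by field.
  move: o0; rewrite /orient => o0.
  apply: (mulfI d0); apply/eqP; rewrite -subr_eq0; apply/eqP.
  transitivity ((p j 0 0 - p i 0 0) * (p k 0 1 - p i 0 1)
     - (p j 0 1 - p i 0 1) * (p k 0 0 - p i 0 0)); last exact: o0.
  by field.
have t0 : t != 0.
  by apply/eqP => t0; apply: (neq i k ik); rewrite tE t0 scale0r addr0.
have t1 : t != 1.
  by apply/eqP => t1; apply: (neq j k jk); rewrite tE t1 scale1r addrC subrK.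
have e0 : p k 0 0 = p i 0 0 + t * (p j 0 0 - p i 0 0) by rewrite tE !mxE.
have e1 : p k 0 1 = p i 0 1 + t * (p j 0 1 - p i 0 1) by rewrite tE !mxE.
have [tn|tp] := ltrP t 0.
  apply: (btw i j k (- t / (1 - t))); rewrite 1?eq_sym //.
    by rewrite ltr_pdivlMr ?ltr_pdivrMr; lra.
  by apply: rV2P; rewrite !mxE ?e0 ?e1; field; lra.
have {}tp : 0 < t by lra.
have [tl|tg] := ltrP t 1.
  apply: (btw k j i t); rewrite ?tp //.
  by apply: rV2P; rewrite !mxE ?e0 ?e1; ring.
have {}tg : 1 < t by lra.
have ti : 0 < t^-1 < 1 by rewrite invr_gt0 invf_lt1 ?tp.
apply: (btw j k i t^-1) => //; first by rewrite eq_sym.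
by apply: rV2P; rewrite !mxE ?e0 ?e1; field.
Qed.

(** Otherwise [p i] would be inside the triangle of the other three points, with the three signed
    areas as barycentric weights. *)
Lemma orient_triangle (R : realType) (n : nat) (p : 'I_n -> 'rV[R]_2)
    (i j k l : 'I_n) :
  convex_position p -> j != i -> k != i -> l != i ->
  0 < orient (p i) (p j) (p k) -> 0 < orient (p i) (p k) (p l) ->
  orient (p i) (p l) (p j) <= 0.
Proof.
move=> hp ji ki li ojk okl; rewrite leNgt; apply/negP => olj.
apply: (@convex_position_comb _ _ _ i j k l _ _ _ hp ji ki li
  (ltW okl) (ltW olj) (ltW ojk)); first lra.
by apply: rV2P; rewrite !mxE /orient; ring.
Qed.

(** [orient_triangle] around [p i] gives the first sign and around [p k] the second; [orient_neq0]
    makes both strict. *)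
Lemma orient_quad (R : realType) (n : nat) (p : 'I_n -> 'rV[R]_2)
    (i j k l : 'I_n) :
  convex_position p -> uniq [:: i; j; k; l] ->
  0 < orient (p i) (p j) (p k) -> 0 < orient (p i) (p k) (p l) ->
  0 < orient (p i) (p j) (p l) /\ 0 < orient (p j) (p k) (p l).
Proof.
rewrite /= !inE !negb_or => hp /andP[/and3P[ij ik il] /and3P[/andP[jk jl] kl _]].
move=> ojk okl.
have ojl : 0 < orient (p i) (p j) (p l).
  have := orient_neq0 hp ij il jl.
  have := orient_triangle hp _ _ _ ojk okl.
  rewrite orient_flip oppr_le0 => ge0; rewrite lt_def => -> /=.
  by apply: ge0; rewrite eq_sym.
split=> //; rewrite lt_def orient_neq0 //=.
have kil : 0 < orient (p k) (p l) (p i) by rewrite orient_cycle.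
have kij : 0 < orient (p k) (p i) (p j) by rewrite -orient_cycle.
have := orient_triangle hp _ _ _ kil kij.
rewrite -orient_cycle orient_flip -orient_cycle oppr_le0; apply=> //.
by rewrite eq_sym.
Qed.

(** Counting predecessors is an injection into ['I_n.+1], hence a bijection, and [v] is its
    inverse. *)
Lemma exists_monotone_enum (n : nat) (lt : rel 'I_n.+1) :
  irreflexive lt -> transitive lt -> (forall i j, i != j -> lt i j || lt j i) ->
  exists v : nat -> 'I_n.+1,
    forall x y : nat, (x < y < n.+1)%N -> lt (v x) (v y).
Proof.
move=> lti ltt ltT; pose rank i := #|[set j | lt j i]|.
have rank_mono i j : lt i j -> (rank i < rank j)%N.
  move=> ij; apply: proper_card; apply/properP; split.
    by apply/fintype.subsetP => k; rewrite !inE => /ltt; apply.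
  by exists i; rewrite !inE ?ij ?lti.
have rankP i : (rank i < n.+1)%N.
  rewrite -[X in (_ < X)%N]card_ord; apply: (@leq_trans #|[set~ i]|.+1).
    rewrite ltnS; apply/subset_leq_card/fintype.subsetP => j; rewrite !inE.
    by apply: contraTneq => ->; rewrite lti.
  by rewrite cardsC1 card_ord.
pose f i := Ordinal (rankP i).
have f_inj : injective f.
  move=> i j [rij]; apply/eqP/negP => /negP /ltT.
  by case/orP=> /rank_mono; rewrite rij ltnn.
exists (fun x => invF f_inj (inord x)) => x y /andP[xy yn].
set i := invF _ _; set j := invF _ _.
have fi : rank i = x.
  by rewrite -[LHS]/(val (f i)) f_invF /= inordK //; apply: ltn_trans xy yn.
have fj : rank j = y by rewrite -[LHS]/(val (f j)) f_invF /= inordK.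
have /ltT : i != j by apply: contraTneq xy => ij; rewrite -fi -fj ij ltnn.
by case/orP=> // /rank_mono; rewrite fi fj ltnNge ltnW.
Qed.

(* The points other than [p 0] are sorted by angle around the extreme point [p 0]. *)
Lemma convex_position_order (R : realType) (n : nat)
    (p : 'I_n.+1 -> 'rV[R]_2) :
  convex_position p ->
  exists v : nat -> 'I_n.+1,
    (forall x y : nat, (x < y < n.+1)%N -> v x != v y) /\
    (forall x y z : nat, (x < y)%N -> (y < z < n.+1)%N ->
      0 < orient (p (v x)) (p (v y)) (p (v z))).
Proof.
move=> hp.
pose lt (j k : 'I_n.+1) :=
  [&& j != k, k != 0 & (j == 0) || (0 < orient (p 0) (p j) (p k))].
have lti : irreflexive lt by move=> j; rewrite /lt eqxx.
have ltT j k : j != k -> lt j k || lt k j.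
  move=> jk; rewrite /lt jk (eq_sym k j) jk /=.
  have [k0|k0] := eqVneq k 0; first by rewrite -k0 jk.
  have [//|j0] := eqVneq j 0; rewrite /= orient_flip oppr_gt0.
  rewrite orbC -neq_lt.
  by rewrite eq_sym; apply: orient_neq0; rewrite // eq_sym.
(* Transitivity around [p 0] is the first conclusion of [orient_quad]; the second one later gives
   the orientation of [v x], [v y], [v z]. *)
have ltt : transitive lt.
  move=> k j l /and3P[jk k0 ojk] /and3P[kl l0 okl]; rewrite /lt l0 /=.
  move: okl; rewrite (negPf k0) /= => okl.
  move: ojk; have [-> _ |j0 /= ojk] := eqVneq j 0; first by rewrite eq_sym l0.
  have [jl|jl] /= := eqVneq j l.
    by move: okl; rewrite orient_flip -jl oppr_gt0 ltNge ltW.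
  have u : uniq [:: 0; j; k; l].
    by rewrite /= !inE !negb_or jk kl jl !(eq_sym 0) j0 k0 l0.
  by have [] := orient_quad hp u ojk okl.
have [v vlt] := exists_monotone_enum lti ltt ltT.
exists v; split=> [x y /vlt /and3P[]//|x y z xy yz].
have /vlt /and3P[nyz z0 oyz] := yz.
have /andP[yz' zn] := yz.
have xyn : (x < y < n.+1)%N by rewrite xy (ltn_trans yz').
have /vlt /and3P[nxy y0 oxy] := xyn.
have xzn : (x < z < n.+1)%N by rewrite (ltn_trans xy).
have /vlt /and3P[nxz _ _] := xzn.
move: oyz oxy; rewrite (negPf y0) /= => oyz.
have [-> //|x0 /= oxy] := eqVneq (v x) 0.
have u : uniq [:: 0; v x; v y; v z].
  by rewrite /= !inE !negb_or nxy nyz nxz !(eq_sym 0) x0 y0 z0.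
by have [] := orient_quad hp u oxy oyz.
Qed.

(** * Extending a family of classes to a coloring *)

Lemma cross_sym (R : realType) (n : nat) (p : 'I_n -> 'rV[R]_2) (e f : edge n) :
  cross p e f -> cross p f e.
Proof. by case=> q [qe qf]; exists q. Qed.

Lemma intersect_sym (R : realType) (n : nat) (p : 'I_n -> 'rV[R]_2)
    (e f : edge n) :
  intersect p e f -> intersect p f e.
Proof.
case=> [[i [ie jf]]|/cross_sym ?]; [by left; exists i|by right].
Qed.

(* Starting from the coloring that merges only [r i] with [t i], a proper
   coloring with the fewest colors among those giving [r i] and [t i] the same
   color is complete; the classes [{r i, t i}] pairwise intersect, so they get
   distinct colors. *)
Lemma alpha1_geq (R : realType) (n : nat) (p : 'I_n -> 'rV[R]_2)
    (I : finType) (r t : I -> edge n) :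
  injective r -> injective t -> (forall i j, r i = t j -> i = j) ->
  (forall i, r i != t i -> ~ intersect p (r i) (t i)) ->
  (forall i j, i != j -> exists e f,
    [/\ e = r i \/ e = t i, f = r j \/ f = t j & intersect p e f]) ->
  (#|I| <= alpha1 p)%N.
Proof.
move=> r_inj t_inj rt disj meet.
pose good k (c : edge n -> 'I_k) :=
  proper_coloring p c /\ forall i, c (r i) = c (t i).
pose Q k := `[< exists c : edge n -> 'I_k, good k c >].
have exQ : exists k, Q k.
  exists #|{: edge n}|; apply/asboolP.
  pose c0 e := if [pick i | t i == e] is Some i then r i else e.
  have c0t i : c0 (t i) = r i.
    rewrite /c0; case: pickP => [j /eqP /t_inj -> //|/(_ i)].
    by rewrite eqxx.
  have c0r i : c0 (r i) = r i.
    by rewrite /c0; case: pickP => [j /eqP /esym /rt -> //|].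
  exists (fun e => enum_rank (c0 e)); split=> [e f ef /enum_rank_inj|i].
    rewrite /c0; case: pickP => [i /eqP ei|_]; case: pickP => [j /eqP fj|_].
    - by move/r_inj => ij; rewrite -ei -fj ij eqxx in ef.
    - by move=> rf /intersect_sym; rewrite -rf -ei; apply: disj; rewrite rf ei eq_sym.
    - by move=> er; rewrite er -fj; apply: disj; rewrite fj -er.
    - by move=> ef'; rewrite ef' eqxx in ef.
  by rewrite c0r c0t.
case: (ex_minnP exQ) => k /asboolP[c [cP crt]] kmin.
(* A good coloring that misses the color [a] could be renumbered through [lift a] with one color
   fewer, against the minimality of [k]. *)
have avoid (g : edge n -> 'I_k) (a : 'I_k) : good k g -> ~ forall e, g e != a.
  case: k c g a cP crt kmin => [|k] c g a _ _ kmin [gP grt] ga; first by case: a ga.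
  have /choice[c' c'E] e : exists x, g e = lift a x.
    by case: (unliftP a (g e)) (ga e) => [x -> _|->]; [exists x|rewrite eqxx].
  have /kmin : Q k by apply/asboolP; exists c'; split=> [e f ef cef|i];
    [apply: gP => //; rewrite !c'E cef|apply: (@lift_inj _ a); rewrite -!c'E].
  by rewrite ltnn.
have c_surj : surjective_coloring c.
  move=> a; apply: contrapT => na; apply: (avoid c a) => // e.
  by apply/eqP => ea; apply: na; exists e.
have c_compl : complete_coloring p c.
  move=> a b ab; apply: contrapT => nab.
  (* Merging [a] into [b] stays proper when no edges of these two colors meet, and it frees the
     color [a]. *)
  pose g e := if c e == a then b else c e.
  apply: (avoid g a); last first.
    by move=> e; rewrite /g; case: ifP => [_|/negbT //]; rewrite eq_sym.
  split=> [e f ef|i]; last by rewrite /g crt.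
  rewrite /g; case: ifP => [/eqP ea|_]; case: ifP => [/eqP fa|_] gef.
  - by apply: cP => //; rewrite ea.
  - by move=> ief; apply: nab; exists e, f.
  - by move=> /intersect_sym ief; apply: nab; exists f, e.
  - exact: cP.
have := (alpha1_max p).2 k; move=> /(_ (ex_intro _ c (And3 c_surj cP c_compl))).
apply: leq_trans; rewrite -[k in (_ <= k)%N]card_ord.
(* If two classes had the same color, their meeting edges [e] and [f] would have to coincide by
   properness, but distinct classes share no edge. *)
apply: (@leq_card _ _ (c \o r)) => i j /= cij; apply/eqP/negP => /negP ij.
have [e [f [er ft ief]]] := meet i j ij.
have ce : c e = c (r i) by case: er => ->.
have cf : c f = c (r j) by case: ft => ->.
apply: (cP e f _ _ ief); last by rewrite ce cf.
apply: contraNneq ij => ef; rewrite -{}ef in ft.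
case: er ft => -> [] /esym.
- by move/r_inj => ->.
- by move/esym /rt => ->.
- by move/rt => ->.
- by move/t_inj => ->.
Qed.

(** * Crossing of segments through orientation signs *)

Lemma open_segment_orient (R : realType) (n : nat) (p : 'I_n -> 'rV[R]_2)
    (a b : 'I_n) (e : edge n) (q : 'rV[R]_2) :
  val e = [set a; b]%SET -> open_segment p e q -> orient (p a) (p b) q = 0.
Proof.
move=> eE [i [j [t [ijE _ ->]]]].
have [ie je] : i \in [set a; b]%SET /\ j \in [set a; b]%SET.
  by rewrite -eE ijE !inE !eqxx orbT.
by move: ie je; rewrite !inE => /orP[]/eqP-> /orP[]/eqP->;
  rewrite /orient !mxE; ring.
Qed.

Lemma open_segment_orient_gt0 (R : realType) (n : nat) (p : 'I_n -> 'rV[R]_2)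
    (c d : 'I_n) (e : edge n) (x y q : 'rV[R]_2) :
  val e = [set c; d]%SET -> 0 < orient x y (p c) -> 0 < orient x y (p d) ->
  open_segment p e q -> 0 < orient x y q.
Proof.
move=> eE oc od [i [j [t [ijE /andP[t0 t1] ->]]]].
have [ie je] : i \in [set c; d]%SET /\ j \in [set c; d]%SET.
  by rewrite -eE ijE !inE !eqxx orbT.
have op k : k \in [set c; d]%SET -> 0 < orient x y (p k).
  by rewrite !inE => /orP[]/eqP->.
have -> : orient x y (t *: p i + (1 - t) *: p j) =
    t * orient x y (p i) + (1 - t) * orient x y (p j).
  by rewrite /orient !mxE; ring.
by rewrite addr_gt0 // mulr_gt0 ?op // subr_gt0.
Qed.

(** The line through [p a] and [p b] contains [e], while [f] stays strictly on its left. *)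
Lemma not_cross (R : realType) (n : nat) (p : 'I_n -> 'rV[R]_2)
    (a b c d : 'I_n) (e f : edge n) :
  val e = [set a; b]%SET -> val f = [set c; d]%SET ->
  0 < orient (p a) (p b) (p c) -> 0 < orient (p a) (p b) (p d) ->
  ~ cross p e f.
Proof.
move=> eE fE oc od [q [/(open_segment_orient eE) qe]].
by move=> /(open_segment_orient_gt0 fE oc od); rewrite qe ltxx.
Qed.

(** The diagonals meet where the ends of each are weighted by the areas of the two triangles cut off
    by the other; [orientD] equates the two total weights. *)
Lemma convex_quad_cross (R : realType) (n : nat) (p : 'I_n -> 'rV[R]_2)
    (a b c d : 'I_n) (e f : edge n) :
  val e = [set a; c]%SET -> val f = [set b; d]%SET ->
  0 < orient (p a) (p b) (p c) -> 0 < orient (p a) (p c) (p d) ->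
  0 < orient (p a) (p b) (p d) -> 0 < orient (p b) (p c) (p d) ->
  cross p e f.
Proof.
move=> eE fE; set s := orient (p a) (p b) (p c); set u := orient (p a) (p c) (p d).
set s' := orient (p a) (p b) (p d); set u' := orient (p b) (p c) (p d).
move=> s0 u0 s'0 u'0; have su : s + u = s' + u' by exact: orientD.
have su0 : 0 < s + u by lra.
have su'0 : 0 < s' + u' by lra.
exists (u / (s + u) *: p b + (1 - u / (s + u)) *: p d); split; last first.
  exists b, d, (u / (s + u)); split=> //.
  by rewrite ltr_pdivlMr // mul0r u0 ltr_pdivrMr //; lra.
exists a, c, (u' / (s' + u')); split=> //.
  by rewrite ltr_pdivlMr // mul0r u'0 ltr_pdivrMr //; lra.
have -> : 1 - u / (s + u) = s / (s + u).
  by field; apply: lt0r_neq0.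
have -> : 1 - u' / (s' + u') = s' / (s' + u').
  by field; apply: lt0r_neq0.
apply: (scalerI (lt0r_neq0 su0)); rewrite [in RHS]su !scalerDr !scalerA.
rewrite !(mulrC _ (_ / _)) !divfK ?lt0r_neq0 //.
by apply: rV2P; rewrite !mxE /s /u /s' /u' /orient; ring.
Qed.

Local Open Scope nat_scope.

(** * Chords of a cyclically labelled polygon *)

Definition between (a b x : nat) : bool := minn a b < x < maxn a b.

Definition chord_meet (a b c d : nat) : bool :=
  [|| a == c, a == d, b == c, b == d | between a b c != between a b d].

(** Reduction modulo [n] for [x < 2n], as a case distinction that stays within linear arithmetic. *)
Definition cyc (n x : nat) : nat := if x < n then x else x - n.

Lemma cycP (n x : nat) :
  (x < n /\ cyc n x = x) \/ (n <= x /\ cyc n x = x - n).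
Proof. by rewrite /cyc; case: ltnP => xn; [left|right]. Qed.

(** A rotation carrying exactly one of [a], [b] past the end of the numbering exchanges the two
    sides of the chord. *)
Lemma between_cyc (n t a b x : nat) :
  t < n -> a < n -> b < n -> x < n -> a != x -> b != x ->
  between (cyc n (a + t)) (cyc n (b + t)) (cyc n (x + t))
    = between a b x (+) ((a + t < n) (+) (b + t < n)).
Proof.
rewrite /between /cyc => tn an bn xn ax bx.
by case: (ltnP (a + t)) => at_n; case: (ltnP (b + t)) => bt_n;
  case: (ltnP (x + t)) => xt_n; rewrite /= ?addbF ?addbT; lia.
Qed.

Lemma cyc_inj (n t a b : nat) : t < n -> a < n -> b < n ->
  (cyc n (a + t) == cyc n (b + t)) = (a == b).
Proof. by rewrite /cyc => tn an bn; case: ltnP => ?; case: ltnP => ?; lia. Qed.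

(** An exchange of sides affects [c] and [d] alike, so whether they are separated does not
    change. *)
Lemma chord_meet_cyc (n t a b c d : nat) :
  t < n -> a < n -> b < n -> c < n -> d < n ->
  chord_meet (cyc n (a + t)) (cyc n (b + t)) (cyc n (c + t)) (cyc n (d + t))
    = chord_meet a b c d.
Proof.
move=> tn an bn cn dn; rewrite /chord_meet !cyc_inj //.
have [//|ac] := eqVneq a c; have [//|ad] := eqVneq a d.
have [//|bc] := eqVneq b c; have [//|bd] := eqVneq b d.
rewrite !between_cyc //=; case: ((a + t < n) (+) (b + t < n));
  by rewrite ?addbT ?addbF ?(inj_eq negb_inj).
Qed.

(* A zigzag covering [s + u] consecutive points does not fit into an open arc with
   fewer points, and a wrapping one would need a longer arc still. *)
Lemma zigzag_outside (n h s u b lo hi : nat) :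
  n = h.*2 \/ n = h.*2.+1 -> b < n ->
  2 <= s <= h -> 2 <= u <= h -> h < s + u -> hi <= lo + h.+1 ->
  lo < cyc n (b + n + 1 - s) < hi -> lo < b < hi ->
  lo < cyc n b.+1 < hi -> lo < cyc n (b + u) < hi -> False.
Proof.
rewrite /cyc => nh bn hs hu hsu hlo.
by case: (ltnP (b + n + 1 - s)) => b1; case: (ltnP b.+1) => b2;
  case: (ltnP (b + u)) => b3; lia.
Qed.

(** The first zigzag is rotated to start at [0]. If the second one missed it, each edge of the
    second would have both ends in one of the three open arcs, and the consecutive labels [b] and
    [b + 1] would put all four ends in the same arc, against [zigzag_outside]. *)
Lemma zigzag_meet0 (n h s u b s' u' : nat) :
  n = h.*2 \/ n = h.*2.+1 -> b < n ->
  2 <= s <= h -> 2 <= u <= h -> h < s + u ->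
  2 <= s' <= h -> 2 <= u' <= h -> h < s' + u' ->
  [|| chord_meet 0 s.-1 (cyc n (b + n + 1 - s')) b,
      chord_meet 0 s.-1 (cyc n b.+1) (cyc n (b + u')),
      chord_meet s (s + u).-1 (cyc n (b + n + 1 - s')) b |
      chord_meet s (s + u).-1 (cyc n b.+1) (cyc n (b + u'))].
Proof.
move=> nh bn hs hu hsu hs' hu' hsu'.
have out := zigzag_outside nh bn hs' hu' hsu'.
move: (out 0 s.-1) (out s (s + u).-1) (out (s + u).-1 n) => {out}.
have : cyc n b.+1 = b.+1 /\ b.+1 < n \/ cyc n b.+1 = 0.
  by rewrite /cyc; case: ltnP; lia.
have : cyc n (b + n + 1 - s') < n by rewrite /cyc; case: (ltnP (b + n + 1 - s')); lia.
have : cyc n (b + u') < n by rewrite /cyc; case: (ltnP (b + u')); lia.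
move: (cyc n (b + n + 1 - s')) (cyc n b.+1) (cyc n (b + u')) => x y z.
move=> zn xn yb o1 o2 o3.
have [s0 su] : 0 <= s.-1 /\ s <= (s + u).-1 by clear -hs hu; lia.
rewrite /chord_meet /between (minn_idPl s0) (maxn_idPr s0).
rewrite (minn_idPl su) (maxn_idPr su); apply/negPn/negP; rewrite !negb_or.
case/and4P=> /and5P[x0 b0 xs bs /negPn/eqP xb1] /and5P[y0 z0 ys zs /negPn/eqP yz1].
move=> /and5P[xs' bs' xu bu /negPn/eqP xb2] /and5P[ys' zs' yu zu /negPn/eqP yz2].
case b1: (0 < b < s.-1).
  have y1 : 0 < y < s.-1 by clear -yb b1 ys y0; case: yb; lia.
  by apply: o1; rewrite ?xb1 -?yz1 //; clear -hs b1; lia.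
case b2: (s < b < (s + u).-1).
  have y2 : s < y < (s + u).-1 by clear -yb b2 yu y0; case: yb; lia.
  by apply: o2; rewrite ?xb2 -?yz2 //; clear -hu b2; lia.
have b3 : (s + u).-1 < b by clear -b0 bs bs' bu b1 b2; lia.
have y3 : (s + u).-1 < y by clear -y0 b3 yb; case: yb; lia.
have z3 : (s + u).-1 < z by move: yz1 yz2; clear -y3 su z0 zs zs' zu; lia.
have x3 : (s + u).-1 < x by move: xb1 xb2; clear -b3 su x0 xs xs' xu; lia.
by apply: o3; clear -nh hsu b3 bn x3 xn y3 yb z3 zn; lia.
Qed.

(** Carries a second zigzag along when the first is rotated to start at [0]; the witness is [b - t]
    modulo [n]. *)
Lemma zigzag_rotate (n s u t b : nat) :
  t < n -> b < n -> 2 <= s <= n -> u < n ->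
  exists2 c, c < n &
    [/\ cyc n (b + n + 1 - s) = cyc n (cyc n (c + n + 1 - s) + t),
        b = cyc n (c + t), cyc n b.+1 = cyc n (cyc n c.+1 + t) &
        cyc n (b + u) = cyc n (cyc n (c + u) + t)].
Proof.
move=> tn bn hs hu; have cE := cycP n (b + (n - t)).
exists (cyc n (b + (n - t))); first by clear -cE bn tn; lia.
move: (cyc n (b + (n - t))) cE => c cE.
have cn : c < n by clear -cE bn tn; lia.
split.
- move: (cycP n (b + n + 1 - s)) (cycP n (c + n + 1 - s))
    (cycP n (cyc n (c + n + 1 - s) + t)).
  by clear -cE cn tn bn hs; lia.
- by move: (cycP n (c + t)); clear -cE cn tn bn; lia.
- move: (cycP n b.+1) (cycP n c.+1) (cycP n (cyc n c.+1 + t)).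
  by clear -cE cn tn bn; lia.
- move: (cycP n (b + u)) (cycP n (c + u)) (cycP n (cyc n (c + u) + t)).
  by clear -cE cn tn bn hu; lia.
Qed.

Lemma zigzag_meet (n h s u b s' u' b' : nat) :
  n = h.*2 \/ n = h.*2.+1 -> b < n -> b' < n ->
  2 <= s <= h -> 2 <= u <= h -> h < s + u ->
  2 <= s' <= h -> 2 <= u' <= h -> h < s' + u' ->
  [|| chord_meet (cyc n (b + n + 1 - s)) b (cyc n (b' + n + 1 - s')) b',
      chord_meet (cyc n (b + n + 1 - s)) b (cyc n b'.+1) (cyc n (b' + u')),
      chord_meet (cyc n b.+1) (cyc n (b + u)) (cyc n (b' + n + 1 - s')) b' |
      chord_meet (cyc n b.+1) (cyc n (b + u)) (cyc n b'.+1) (cyc n (b' + u'))].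
Proof.
move=> nh bn b'n hs hu hsu hs' hu' hsu'.
have tE := cycP n (b + n + 1 - s).
pose t := cyc n (b + n + 1 - s).
have p1 : cyc n (b + n + 1 - s) = cyc n (0 + t).
  by rewrite add0n -/t; move: (cycP n t) tE; rewrite -/t; clear -bn hs; lia.
have tn : t < n by move: tE; rewrite -/t; clear -hs bn; lia.
have p2 : b = cyc n (s.-1 + t).
  by move: tE (cycP n (s.-1 + t)); rewrite -/t; clear -bn hs nh; lia.
have p3 : cyc n b.+1 = cyc n (s + t).
  by move: tE (cycP n (s + t)) (cycP n b.+1); rewrite -/t; clear -bn hs nh; lia.
have p4 : cyc n (b + u) = cyc n ((s + u).-1 + t).
  move: tE (cycP n ((s + u).-1 + t)) (cycP n (b + u)); rewrite -/t.
  by clear -bn hs hu nh; lia.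
clear tE; move: t tn p1 p2 p3 p4 => t tn p1 p2 p3 p4.
have hs'n : 2 <= s' <= n by clear -nh hs'; lia.
have hu'n : u' < n by clear -nh hu'; lia.
have [c cn [c1 c2 c3 c4]] := zigzag_rotate tn b'n hs'n hu'n.
rewrite c1 c3 c4 p1 p3 p4 p2 c2.
have lt1 : cyc n (c + n + 1 - s') < n.
  by move: (cycP n (c + n + 1 - s')); clear -cn hs'; lia.
have lt3 : cyc n c.+1 < n by move: (cycP n c.+1); clear -cn; lia.
have lt4 : cyc n (c + u') < n.
  by move: (cycP n (c + u')); clear -cn hu' nh; lia.
have [l1 [l2 [l3 l4]]] : 0 < n /\ s.-1 < n /\ s < n /\ (s + u).-1 < n.
  by clear -hs hu nh tn; lia.
rewrite !chord_meet_cyc //; exact: zigzag_meet0 nh cn hs hu hsu hs' hu' hsu'.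
Qed.

(** The single edge leaves at most [h] points on either side, too few for a zigzag by
    [zigzag_outside]. *)
Lemma single_zigzag_meet0 (n h r b s u : nat) :
  n = h.*2 /\ h <= r <= h.+1 \/ n = h.*2.+1 /\ r = h.+1 -> b < n ->
  2 <= r -> 2 <= s <= h -> 2 <= u <= h -> h < s + u ->
  chord_meet 0 r.-1 (cyc n (b + n + 1 - s)) b ||
  chord_meet 0 r.-1 (cyc n b.+1) (cyc n (b + u)).
Proof.
move=> nr bn hr hs hu hsu.
have nh : n = h.*2 \/ n = h.*2.+1 by clear -nr; lia.
have out := zigzag_outside nh bn hs hu hsu.
move: (out 0 r.-1) (out r.-1 n) => {out}.
have : cyc n b.+1 = b.+1 /\ b.+1 < n \/ cyc n b.+1 = 0.
  by rewrite /cyc; case: ltnP; lia.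
have : cyc n (b + n + 1 - s) < n by rewrite /cyc; case: (ltnP (b + n + 1 - s)); lia.
have : cyc n (b + u) < n by rewrite /cyc; case: (ltnP (b + u)); lia.
move: (cyc n (b + n + 1 - s)) (cyc n b.+1) (cyc n (b + u)) => x y z.
move=> zn xn yb o1 o2.
have r0 : 0 <= r.-1 by [].
rewrite /chord_meet /between (minn_idPl r0) (maxn_idPr r0).
apply/negPn/negP; rewrite !negb_or.
case/andP=> /and5P[x0 b0 xr br /negPn/eqP xb1] /and5P[y0 z0 yr zr /negPn/eqP yz1].
case b1: (0 < b < r.-1).
  have y1 : 0 < y < r.-1 by clear -yb b1 y0 yr; case: yb; lia.
  by apply: o1; rewrite ?xb1 -?yz1 //; clear -nr b1; lia.
have b2 : r.-1 < b by clear -b0 br b1; lia.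
have y2 : r.-1 < y by clear -y0 b2 yb; case: yb; lia.
have z2 : r.-1 < z by move: yz1; clear -y2 z0 zr; lia.
have x2 : r.-1 < x by move: xb1; clear -b2 x0 xr; lia.
by apply: o2; clear -nr b2 bn x2 xn y2 yb z2 zn; lia.
Qed.

Lemma single_zigzag_meet (n h r a b s u : nat) :
  n = h.*2 /\ h <= r <= h.+1 \/ n = h.*2.+1 /\ r = h.+1 -> a < n -> b < n ->
  2 <= r -> 2 <= s <= h -> 2 <= u <= h -> h < s + u ->
  chord_meet (cyc n (a + n + 1 - r)) a (cyc n (b + n + 1 - s)) b ||
  chord_meet (cyc n (a + n + 1 - r)) a (cyc n b.+1) (cyc n (b + u)).
Proof.
move=> nr an bn hr hs hu hsu.
have tE := cycP n (a + n + 1 - r).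
pose t := cyc n (a + n + 1 - r).
have p1 : cyc n (a + n + 1 - r) = cyc n (0 + t).
  by rewrite add0n -/t; move: (cycP n t) tE; rewrite -/t; clear -an hr; lia.
have tn : t < n by move: tE; rewrite -/t; clear -hr nr an; lia.
have p2 : a = cyc n (r.-1 + t).
  by move: tE (cycP n (r.-1 + t)); rewrite -/t; clear -an hr nr; lia.
clear tE; move: t tn p1 p2 => t tn p1 p2.
have hsn : 2 <= s <= n by clear -nr hs; lia.
have hun : u < n by clear -nr hu; lia.
have [c cn [c1 c2 c3 c4]] := zigzag_rotate tn bn hsn hun.
rewrite c1 c3 c4 p1 p2 c2.
have lt1 : cyc n (c + n + 1 - s) < n.
  by move: (cycP n (c + n + 1 - s)); clear -cn hs; lia.
have lt3 : cyc n c.+1 < n by move: (cycP n c.+1); clear -cn; lia.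
have lt4 : cyc n (c + u) < n.
  by move: (cycP n (c + u)); clear -cn hun; lia.
have [l1 l2] : 0 < n /\ r.-1 < n by clear -hr nr tn; lia.
rewrite !chord_meet_cyc //; exact: single_zigzag_meet0 nr cn hr hs hu hsu.
Qed.

(** Disjoint edges cut off disjoint runs of points, ends included. The shorter run of each edge has
    [h + 1] points, or [h] if [n = 2h] and its span is [h], so only two complementary runs of [h]
    points fit; this is the excluded case. *)
Lemma single_meet (n h r r' a a' : nat) :
  n = h.*2 /\ h <= r <= h.+1 /\ h <= r' <= h.+1 \/
  n = h.*2.+1 /\ r = h.+1 /\ r' = h.+1 ->
  2 <= r -> 2 <= r' -> a < n -> a' < n -> a != a' ->
  ~~ [&& n == h.*2, r == h, r' == h & (a' == a + h) || (a == a' + h)] ->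
  chord_meet (cyc n (a + n + 1 - r)) a (cyc n (a' + n + 1 - r')) a'.
Proof.
move=> nr hr hr' an an' aa' excl.
have tE := cycP n (a + n + 1 - r).
have tE' := cycP n (a' + n + 1 - r').
move: (cyc n (a + n + 1 - r)) (cyc n (a' + n + 1 - r')) tE tE' => x y xE yE.
rewrite /chord_meet /between.
case: (leqP x a) => xa; rewrite ?(minn_idPl xa) ?(maxn_idPr xa)
  ?(minn_idPr (ltnW xa)) ?(maxn_idPl (ltnW xa)).
  lia.
lia.
Qed.

(** * From labelled chords to edges of the geometric graph *)

Lemma chord_meetCl (a b c d : nat) : chord_meet b a c d = chord_meet a b c d.
Proof.
rewrite /chord_meet /between minnC maxnC.
by case: (a == c); case: (a == d); case: (b == c); case: (b == d).
Qed.

Lemma chord_meetCr (a b c d : nat) : chord_meet a b d c = chord_meet a b c d.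
Proof.
rewrite /chord_meet [between a b d == _]eq_sym.
by case: (a == c); case: (a == d); case: (b == c); case: (b == d).
Qed.

Definition convex_order (R : realType) (n : nat) (p : 'I_n -> 'rV[R]_2)
    (v : nat -> 'I_n) : Prop :=
  (forall x y, x < y < n -> v x != v y) /\
  (forall x y z, x < y -> y < z < n ->
     (0 < orient (p (v x)) (p (v y)) (p (v z)))%R).

Lemma convex_order_inj (R : realType) (n : nat) (p : 'I_n -> 'rV[R]_2)
    (v : nat -> 'I_n) (x y : nat) :
  convex_order p v -> x < n -> y < n -> v x = v y -> x = y.
Proof.
move=> [vn _] xn yn vxy; case: (ltngtP x y) => // xy.
  by have := vn x y; rewrite xy yn vxy eqxx => /(_ isT).
by have := vn y x; rewrite xy xn vxy eqxx => /(_ isT).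
Qed.

Lemma chord_meetP (R : realType) (n : nat) (p : 'I_n -> 'rV[R]_2)
    (v : nat -> 'I_n) (a b c d : nat) (e f : edge n) :
  convex_order p v -> a < n -> b < n -> c < n -> d < n -> a != b -> c != d ->
  val e = [set v a; v b]%SET -> val f = [set v c; v d]%SET ->
  chord_meet a b c d <-> intersect p e f.
Proof.
move=> hv.
wlog ab : a b / a < b.
  move=> W an bn cn dn ab; case: (ltngtP a b) ab => // ab _ cd eE fE.
    by apply: W => //; rewrite neq_ltn ?ab ?cd.
  by rewrite -chord_meetCl; apply: W => //; rewrite ?neq_ltn ?ab ?cd ?orbT // finset.setUC.
wlog cd : c d / c < d.
  move=> W an bn cn dn nab; case: (ltngtP c d) => // cd _ eE fE.
    by apply: W => //; rewrite neq_ltn ?ab ?cd.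
  by rewrite -chord_meetCr; apply: W => //; rewrite ?neq_ltn ?ab ?cd ?orbT // finset.setUC.
move=> an bn cn dn _ _ eE fE.
have vinj := convex_order_inj hv.
have vo x y z : x < y -> y < z -> z < n ->
    (0 < orient (p (v x)) (p (v y)) (p (v z)))%R.
  by move=> xy yz zn; apply: hv.2 => //; rewrite yz.
have vo' x y z : x < y -> y < z -> z < n ->
    (0 < orient (p (v y)) (p (v z)) (p (v x)))%R.
  by move=> xy yz zn; rewrite orient_cycle vo.
have vo'' x y z : x < y -> y < z -> z < n ->
    (0 < orient (p (v z)) (p (v x)) (p (v y)))%R.
  by move=> xy yz zn; rewrite -orient_cycle vo.
split.
  have share x : x \in [set v a; v b]%SET -> x \in [set v c; v d]%SET ->
      intersect p e f by rewrite -eE -fE => xe xf; left; exists x.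
  case/or4P=> [/eqP E|/eqP E|/eqP E|].
  - by apply: (share (v a)); rewrite !inE -?E eqxx ?orbT.
  - by apply: (share (v a)); rewrite !inE -?E eqxx ?orbT.
  - by apply: (share (v b)); rewrite !inE -?E eqxx ?orbT.
  case/orP => [/eqP E|].
    by apply: (share (v b)); rewrite !inE -?E eqxx ?orbT.
  rewrite /between (minn_idPl (ltnW ab)) (maxn_idPr (ltnW ab)) => bt.
  case: (eqVneq a c) => [E|ac].
    by apply: (share (v a)); rewrite !inE -?E eqxx ?orbT.
  case: (eqVneq b c) => [E|bc].
    by apply: (share (v b)); rewrite !inE -?E eqxx ?orbT.
  case: (eqVneq a d) => [E|ad].
    by apply: (share (v a)); rewrite !inE -?E eqxx ?orbT.
  case: (eqVneq b d) => [E|bd].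
    by apply: (share (v b)); rewrite !inE -?E eqxx ?orbT.
  have [[ac' [cb bd']]|[ca [ad' db]]] :
      a < c /\ c < b /\ b < d \/ c < a /\ a < d /\ d < b.
    by clear -ab cd bt ac bc ad bd; lia.
  - right; apply: (convex_quad_cross eE fE); apply: vo => //; lia.
  - right; apply: cross_sym; apply: (convex_quad_cross fE eE); apply: vo => //; lia.
apply: contraPT; rewrite /chord_meet !negb_or => /and5P[ac ad bc bd].
rewrite /between (minn_idPl (ltnW ab)) (maxn_idPr (ltnW ab)) negbK => /eqP bt.
case=> [[i []]|].
  rewrite eE fE !inE => /orP[]/eqP-> /orP[]/eqP/vinj E.
  - by move: ac; rewrite E ?eqxx.
  - by move: ad; rewrite E ?eqxx.
  - by move: bc; rewrite E ?eqxx.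
  - by move: bd; rewrite E ?eqxx.
have eE' : val e = [set v b; v a]%SET by rewrite finset.setUC.
have fE' : val f = [set v d; v c]%SET by rewrite finset.setUC.
(* The second chord comes after, before, inside or around the first. In each case one chord lies
   strictly to the left of the line through the other, which is directed backwards when its labels
   enclose the other chord. *)
have [|[|[|]]] : b < c \/ d < a \/ a < c /\ d < b \/ c < a /\ b < d.
  by clear -ab cd bt ac bc ad bd; lia.
- move=> bc'; apply: (not_cross eE fE); [exact: vo|apply: vo => //; lia].
- by move=> da; apply: (not_cross eE fE); [apply: vo' => //; lia|apply: vo'].
- move=> [ac' db]; apply: (not_cross eE' fE); [apply: vo'' => //; lia|].
  by apply: vo'' => //; lia.
- move=> [ca bd'] /cross_sym; apply: (not_cross fE' eE).
    by apply: vo'' => //; lia.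
  by apply: vo'' => //; lia.
Qed.

(** * Zigzag matchings *)

(* A pair (b, s) encodes the edge from b - s + 1 to b, spanning s consecutive points
   with last point b. Encodings with 2 <= s <= tp b are the short edges, those with
   s = tp b + 1 the single-edge classes; for n = 2h the alternative tp b = h or h - 1
   selects one edge of each antipodal pair of span h. A short edge (b, s) is the
   left edge of a zigzag iff lo b <= s <= hi b, and its right edge then spans the
   next u b s points. *)
Record zigzag_plan (n h : nat) (tp lo hi : nat -> nat)
    (u : nat -> nat -> nat) : Prop := ZigzagPlan {
  plan_half : n = h.*2 \/ n = h.*2.+1;
  plan_top : forall b, b < n -> 1 <= tp b /\ h.-1 <= tp b <= h;
  plan_top_odd : n = h.*2.+1 -> forall b, b < n -> tp b = h;
  plan_top_even : n = h.*2 -> forall b, b < h -> (tp b == h) != (tp (b + h) == h);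
  plan_lo : forall b, b < n -> 2 <= lo b;
  plan_hi : forall b, b < n -> hi b <= tp b;
  plan_partner : forall b s, b < n -> lo b <= s <= hi b ->
    [/\ 2 <= u b s <= h, h < s + u b s, u b s <= tp (cyc n (b + u b s)) &
        ~~ (lo (cyc n (b + u b s)) <= u b s <= hi (cyc n (b + u b s)))];
  plan_partner_inj : forall b s s', b < n -> lo b <= s <= hi b ->
    lo b <= s' <= hi b -> u b s = u b s' -> s = s' }.

(** Only a diameter, with [n = 2h] and span [h + 1], can be encoded from either of its ends. *)
Lemma chord_eq (n h : nat) (b s b' s' : nat) :
  n = h.*2 \/ n = h.*2.+1 -> b < n -> b' < n ->
  2 <= s <= h.+1 -> 2 <= s' <= h.+1 ->
  cyc n (b + n + 1 - s) = cyc n (b' + n + 1 - s') /\ b = b' \/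
  cyc n (b + n + 1 - s) = b' /\ b = cyc n (b' + n + 1 - s') ->
  b = b' /\ s = s' \/
  [/\ n = h.*2, s = h.+1, s' = h.+1 & b = b' + h \/ b' = b + h].
Proof.
move=> nh bn b'n hs hs'.
move: (cycP n (b + n + 1 - s)) (cycP n (b' + n + 1 - s')) => xE yE E.
have : b = b' /\ s = s' \/ (n = h.*2 /\ s = h.+1 /\ s' = h.+1) /\
   (b = b' + h \/ b' = b + h) by lia.
by case=> [|[[n2 [-> ->]]]]; [left|right].
Qed.

Lemma cyc_lt (n x : nat) : x < n.*2 -> cyc n x < n.
Proof. by move: (cycP n x); lia. Qed.

(** The right edge of a zigzag at [b], encoded by its last point and its span [u], starts right
    after [b]. *)
Lemma cyc_chord (n b u : nat) : b < n -> 0 < u <= n ->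
  cyc n (cyc n (b + u) + n + 1 - u) = cyc n b.+1.
Proof.
move=> bn hu; move: (cycP n (b + u)) (cycP n b.+1)
  (cycP n (cyc n (b + u) + n + 1 - u)); lia.
Qed.

(** The two consecutive runs have [s + u <= 2h <= n] points in all, so they do not overlap. *)
Lemma zigzag_disjoint (n h s u b : nat) :
  n = h.*2 \/ n = h.*2.+1 -> b < n -> 2 <= s <= h -> 2 <= u <= h ->
  ~~ chord_meet (cyc n (b + n + 1 - s)) b (cyc n b.+1) (cyc n (b + u)).
Proof.
move=> nh bn hs hu.
move: (cycP n (b + n + 1 - s)) (cycP n b.+1) (cycP n (b + u)).
move: (cyc n (b + n + 1 - s)) (cyc n b.+1) (cyc n (b + u)) => x y z xE yE zE.
rewrite /chord_meet /between.
case: xE => -[c1 ->]; case: yE => -[c2 ->]; case: zE => -[c3 ->]; lia.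
Qed.

Lemma chord_meetC (a b c d : nat) : a != b -> c != d ->
  chord_meet a b c d = chord_meet c d a b.
Proof. by move=> ab cd; rewrite /chord_meet /between; lia. Qed.

Lemma set2_eq (T : finType) (a b c d : T) :
  [set a; b]%SET = [set c; d]%SET -> a = c /\ b = d \/ a = d /\ b = c.
Proof.
move=> E.
have : a \in [set c; d]%SET by rewrite -E !inE eqxx.
have : b \in [set c; d]%SET by rewrite -E !inE eqxx orbT.
have : c \in [set a; b]%SET by rewrite E !inE eqxx.
have : d \in [set a; b]%SET by rewrite E !inE eqxx orbT.
rewrite !inE => /orP[]/eqP-> /orP[]/eqP-> /orP[]/eqP e1 /orP[]/eqP e2; auto.
Qed.

Lemma zigzag_alpha1 (R : realType) (n h : nat) (p : 'I_n -> 'rV[R]_2)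
    (v : nat -> 'I_n) (tp lo hi : nat -> nat) (u : nat -> nat -> nat)
    (I : finType) (B S : I -> nat) :
  convex_order p v -> zigzag_plan n h tp lo hi u ->
  (forall i, B i < n) ->
  (forall i, lo (B i) <= S i <= hi (B i) \/ S i = (tp (B i)).+1) ->
  (forall i j, B i = B j -> S i = S j -> i = j) ->
  #|I| <= alpha1 p.
Proof.
move=> hv [nh top topo tope lo2 hitp part partinj] Bn Ss BSinj.
pose pr i := lo (B i) <= S i <= hi (B i).
(* [(BT i, U i)] encodes the right edge of a zigzag. On a single-edge class it repeats [(B i, S i)],
   so that [r i = t i] there. *)
pose U i := if pr i then u (B i) (S i) else S i.
pose BT i := if pr i then cyc n (B i + U i) else B i.
have single i : ~~ pr i -> S i = (tp (B i)).+1.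
  by case: (Ss i) => // pri; rewrite /pr pri.
have valid_S i : 2 <= S i <= (tp (B i)).+1.
  have := top _ (Bn i); have := lo2 _ (Bn i); have := hitp _ (Bn i).
  by have := Ss i; lia.
have pairP i : pr i -> [/\ 2 <= U i <= h, h < S i + U i, U i <= tp (BT i) &
    ~~ (lo (BT i) <= U i <= hi (BT i))].
  by move=> pri; rewrite /BT /U pri; apply: part.
have tp_le b : b < n -> tp b <= h by move=> /top [_ /andP[]].
have pair_Sh i : pr i -> 2 <= S i <= h.
  rewrite /pr; have := tp_le _ (Bn i); have := lo2 _ (Bn i).
  by have := hitp _ (Bn i); lia.
have BTn i : BT i < n.
  rewrite /BT; case: ifP => // /pairP[Ui _ _ _]; apply: cyc_lt.
  by have := Bn i; clear -Ui nh; lia.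
have U2 i : 2 <= U i.
  case pri: (pr i); first by have [/andP[]] := pairP i pri.
  by rewrite /U pri; case/andP: (valid_S i).
have valid_U i : U i <= (tp (BT i)).+1.
  case pri: (pr i); first by have [_ _ /leqW] := pairP i pri.
  by rewrite /U /BT pri; case/andP: (valid_S i).
(* When n is even a diameter has two encodings, but only one has s <= tp b + 1. *)
have valid_eq b s b' s' : b < n -> b' < n -> 2 <= s <= (tp b).+1 ->
    2 <= s' <= (tp b').+1 ->
    [set v (cyc n (b + n + 1 - s)); v b]%SET =
      [set v (cyc n (b' + n + 1 - s')); v b']%SET -> b = b' /\ s = s'.
  move=> bn b'n hs hs' /set2_eq E.
  have tb := tp_le b bn; have tb' := tp_le b' b'n.
  have sn x y : x < n -> 2 <= y <= h.+1 -> cyc n (x + n + 1 - y) < n.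
    by clear=> xn hy; apply: cyc_lt; lia.
  have hs1 : 2 <= s <= h.+1 by clear -hs tb; lia.
  have hs1' : 2 <= s' <= h.+1 by clear -hs' tb'; lia.
  have inj := convex_order_inj hv.
  have {}E : cyc n (b + n + 1 - s) = cyc n (b' + n + 1 - s') /\ b = b' \/
     cyc n (b + n + 1 - s) = b' /\ b = cyc n (b' + n + 1 - s').
    have xn := sn b s bn hs1; have yn := sn b' s' b'n hs1'.
    case: E => -[E1 E2]; [left|right]; split.
    - exact: inj xn yn E1.
    - exact: inj bn b'n E2.
    - exact: inj xn b'n E1.
    - exact: inj bn yn E2.
  have [//|[n2 sE s'E bb']] := chord_eq nh bn b'n hs1 hs1' E.
  have tbE : tp b = h by clear -hs tb sE; lia.
  have tbE' : tp b' = h by clear -hs' tb' s'E; lia.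
  case: bb' => bE; [have := tope n2 b'|have := tope n2 b].
    by rewrite -bE tbE tbE' eqxx => H; have /H : b' < h by clear -bE bn n2; lia.
  by rewrite -bE tbE tbE' eqxx => H; have /H : b < h by clear -bE b'n n2; lia.
have ends_neq b s : b < n -> 2 <= s <= h.+1 -> cyc n (b + n + 1 - s) != b.
  move=> bn hs; move: (cycP n (b + n + 1 - s)); clear -bn hs nh; lia.
have ends_lt b s : b < n -> 2 <= s -> cyc n (b + n + 1 - s) < n.
  by clear=> bn hs; apply: cyc_lt; lia.
have edgeP b s : b < n -> 2 <= s <= (tp b).+1 ->
    exists e : edge n, val e = [set v (cyc n (b + n + 1 - s)); v b]%SET.
  move=> bn hs; have tb := tp_le b bn.
  have hs1 : 2 <= s <= h.+1 by clear -hs tb; lia.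
  have /eqP vn : v (cyc n (b + n + 1 - s)) <> v b.
    move/(convex_order_inj hv) => /(_ (ends_lt _ _ _ _) bn) E.
    have := ends_neq b s bn hs1; rewrite E ?eqxx //.
    by case/andP: hs1.
  have e2 : #|[set v (cyc n (b + n + 1 - s)); v b]%SET| == 2.
    by rewrite cards2 vn.
  by exists (exist (fun e : {set 'I_n} => #|e| == 2) _ e2).
have validU i : 2 <= U i <= (tp (BT i)).+1 by rewrite U2 valid_U.
have [r rE] := choice (fun i => edgeP _ _ (Bn i) (valid_S i)).
have [t tE] := choice (fun i => edgeP _ _ (BTn i) (validU i)).
have chordP b s b' s' e f := fun bn b'n hs hs' =>
  @chord_meetP _ _ p v (cyc n (b + n + 1 - s)) b (cyc n (b' + n + 1 - s')) b' e f hv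
    (ends_lt b s bn (proj1 (andP hs))) bn (ends_lt b' s' b'n (proj1 (andP hs'))) b'n
    (ends_neq b s bn hs) (ends_neq b' s' b'n hs').
have BTE i : pr i -> BT i = cyc n (B i + U i) by rewrite /BT => ->.
have tends i : pr i -> cyc n (BT i + n + 1 - U i) = cyc n (B i).+1.
  move=> pri; rewrite BTE // cyc_chord //.
  by have [Ui _ _ _] := pairP i pri; clear -Ui nh; lia.
(* By [plan_partner], the right edge of a zigzag has span at most [tp] and lies outside the range of
   left edges, so equality forces [j] to be a single-edge class. *)
have rt i j : r i = t j -> i = j.
  move/(congr1 val); rewrite rE tE => /valid_eq.
  case/(_ (Bn i) (BTn j) (valid_S i) (validU j)) => bE sE.
  case prj: (pr j).
    have [_ _ Utp] := pairP j prj; rewrite -bE -sE.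
    by case: (Ss i) => [->//|E]; move: Utp; rewrite -bE -sE E ltnn.
  by apply: BSinj; [move: bE; rewrite /BT prj|move: sE; rewrite /U prj].
apply: (@alpha1_geq _ _ _ I r t) => //.
- move=> i j /(congr1 val); rewrite !rE => /valid_eq.
  by case/(_ (Bn i) (Bn j) (valid_S i) (valid_S j)); apply: BSinj.
- move=> i j tij; have := congr1 val tij; rewrite !tE => /valid_eq.
  case/(_ (BTn i) (BTn j) (validU i) (validU j)) => bE uE.
  case pri: (pr i); last first.
    apply: rt; rewrite -tij; apply: val_inj; rewrite rE tE /BT /U.
    by rewrite pri.
  case prj: (pr j); last first.
    apply/esym/rt; rewrite tij; apply: val_inj; rewrite rE tE /BT /U.
    by rewrite prj.
  have [Ui _ _ _] := pairP i pri; have [Uj _ _ _] := pairP j prj.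
  move: bE; rewrite {1}/BT {1}/BT pri prj uE => bE.
  have {}bE : B i = B j.
    move: bE (cycP n (B i + U j)) (cycP n (B j + U j)) (Bn i) (Bn j).
    by clear -Uj nh; lia.
  apply: BSinj => //; apply: (partinj (B i)) => //; first by rewrite bE.
  by move: uE; rewrite /U pri prj bE.
- move=> i rti; have pri : pr i.
    by apply: contraNT rti => /negPf pri; apply/eqP/val_inj; rewrite rE tE /BT /U pri.
  have [Ui SU _ _] := pairP i pri; have Si := pair_Sh i pri.
  have Si1 : 2 <= S i <= h.+1 by clear -Si; lia.
  have Ui1 : 2 <= U i <= h.+1 by clear -Ui; lia.
  move/(proj2 (chordP _ _ _ _ _ _ (Bn i) (BTn i) Si1 Ui1 (rE i) (tE i))).
  by rewrite tends // BTE //; apply/negP/(zigzag_disjoint nh).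
- move=> i j ij.
  have S1 k : 2 <= S k <= h.+1.
    by have := valid_S k; have := tp_le _ (Bn k); clear; lia.
  have U1 k : 2 <= U k <= h.+1.
    by have := validU k; have := tp_le _ (BTn k); clear; lia.
  have rr := chordP _ _ _ _ _ _ (Bn i) (Bn j) (S1 i) (S1 j) (rE i) (rE j).
  have rt' := chordP _ _ _ _ _ _ (Bn i) (BTn j) (S1 i) (U1 j) (rE i) (tE j).
  have tr := chordP _ _ _ _ _ _ (BTn i) (Bn j) (U1 i) (S1 j) (tE i) (rE j).
  have tt := chordP _ _ _ _ _ _ (BTn i) (BTn j) (U1 i) (U1 j) (tE i) (tE j).
  have single_size k : ~~ pr k ->
      n = h.*2 /\ h <= S k <= h.+1 \/ n = h.*2.+1 /\ S k = h.+1.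
    move=> /single ->; have [_ tk] := top _ (Bn k).
    case: nh => [n2|n1]; [left|right]; split=> //.
      by clear -tk; lia.
    by rewrite topo.
  case pri: (pr i); case prj: (pr j).
  - have [Ui SUi _ _] := pairP i pri; have [Uj SUj _ _] := pairP j prj.
    have := zigzag_meet nh (Bn i) (Bn j) (pair_Sh i pri) Ui SUi (pair_Sh j prj) Uj SUj.
    rewrite -(tends i) // -(tends j) // -(BTE i) // -(BTE j) //.
    case/or4P => [/rr|/rt'|/tr|/tt] ief.
    + by exists (r i), (r j); split; [left|left|].
    + by exists (r i), (t j); split; [left|right|].
    + by exists (t i), (r j); split; [right|left|].
    + by exists (t i), (t j); split; [right|right|].
  - have [Ui SUi _ _] := pairP i pri.
    have := single_zigzag_meet (single_size j (negbT prj)) (Bn j) (Bn i)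
      (proj1 (andP (S1 j))) (pair_Sh i pri) Ui SUi.
    rewrite -(tends i) // -(BTE i) // ; case/orP; rewrite chord_meetC ?ends_neq //.
      by move=> /rr ief; exists (r i), (r j); split; [left|left|].
    by move=> /tr ief; exists (t i), (r j); split; [right|left|].
  - have [Uj SUj _ _] := pairP j prj.
    have := single_zigzag_meet (single_size i (negbT pri)) (Bn i) (Bn j)
      (proj1 (andP (S1 i))) (pair_Sh j prj) Uj SUj.
    rewrite -(tends j) // -(BTE j) // => /orP[].
      by move=> /rr ief; exists (r i), (r j); split; [left|left|].
    by move=> /rt' ief; exists (r i), (t j); split; [left|right|].
  exists (r i), (r j); split; [by left|by left|apply/rr].
  have [Si Sj] := (single i (negbT pri), single j (negbT prj)).
  have nij : B i != B j.
    by apply: contraNneq ij => bij; apply/eqP/BSinj; rewrite ?Si ?Sj bij.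
  apply: (@single_meet n h) => //.
  + have := single_size i (negbT pri); have := single_size j (negbT prj).
    by clear; lia.
  + by case/andP: (S1 i).
  + by case/andP: (S1 j).
  (* Two disjoint single edges would have span [h] at antipodal labels, but [plan_top_even] gives
     [tp] the value [h] at one of these. *)
  apply/negP => /and4P[/eqP n2]; rewrite Si Sj => /eqP ti /eqP tj.
  case/orP => /eqP bE.
    have := tope n2 (B i); rewrite -bE.
    have Bih : B i < h by have := Bn j; clear -bE n2; lia.
    move/(_ Bih); clear -ti tj; lia.
  have := tope n2 (B j); rewrite -bE.
  have Bjh : B j < h by have := Bn i; clear -bE n2; lia.
  by move/(_ Bjh); clear -ti tj; lia.
Qed.

Lemma zigzag_plan_alpha1 (R : realType) (n h : nat) (p : 'I_n.+1 -> 'rV[R]_2)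
    (tp lo hi : nat -> nat) (u : nat -> nat -> nat) :
  convex_position p -> zigzag_plan n.+1 h tp lo hi u ->
  \sum_(b < n.+1) (hi b + 2 - lo b) <= alpha1 p.
Proof.
move=> hp plan; have [v hv] := convex_position_order hp.
pose I := {b : 'I_n.+1 & 'I_(hi b + 2 - lo b)}.
(* The last index [j] overshoots [hi b] and encodes the single edge of span [tp b + 1]. *)
pose s (b j : nat) := if lo b + j <= hi b then lo b + j else (tp b).+1.
have s_inj b j j' : b < n.+1 -> j < hi b + 2 - lo b -> j' < hi b + 2 - lo b ->
    s b j = s b j' -> j = j'.
  move=> /(plan_hi plan); rewrite /s; case: ifP; case: ifP; lia.
have -> : \sum_(b < n.+1) (hi b + 2 - lo b) = #|{: I}|.
  by rewrite card_tagged sumnE big_map big_enum; apply: eq_bigr => b _; rewrite card_ord.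
apply: (@zigzag_alpha1 _ _ _ p v _ _ _ _ I (fun i => tag i)
  (fun i => s (tag i) (tagged i)) hv plan).
- by move=> i; apply: ltn_ord.
- move=> [b j] /=; rewrite /s; case: ifP => jb; [left|by right].
  by rewrite jb leq_addr.
- move=> [b j] [b' j'] /= /val_inj bE; case: _ / bE j' => j' sE.
  congr existT; apply: val_inj; apply: s_inj sE => //; exact: ltn_ord.
Qed.

(** * Matchings for the residues of [n] modulo 4 *)

Lemma sum_interval (n x y : nat) : y <= n -> \sum_(b < n) (x <= b < y) = y - x.
Proof.
move=> yn; rewrite -(big_mkord xpredT (fun b => (x <= b < y : nat))).
elim: n y yn => [|n IH] y yn; first by rewrite big_geq //; lia.
rewrite big_nat_recr //=; case: (ltngtP y n.+1) yn => // [yn|->] _.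
  by rewrite IH //; lia.
rewrite (eq_big_nat _ _ (F2 := fun b => (x <= b < n : nat))) ?IH //; last first.
  by move=> b /andP[_ bn]; congr (nat_of_bool (_ && _)); lia.
lia.
Qed.

(* Only an exact matching reaches the bound here. The spans s and u add up to 2q + 2
   or 2q + 1 according to tp b; the entries at b = 1, q + 1 and 3q + 1 repair the
   defects of this rule by rerouting one edge of span q and one of span 2q. For
   q = 1 the former would be a point, and the bound fails for n = 4. *)
Lemma alpha1_ge_4q (R : realType) (n q : nat) (p : 'I_n.+1 -> 'rV[R]_2) :
  convex_position p -> n.+1 = 4 * q -> 2 <= q -> 4 * q * q + q <= alpha1 p.
Proof.
move=> hp nE q2.
(* [P] selects one label from each antipodal pair [b], [b + 2q], as [plan_top_even] demands. *)
pose P b := [|| 0 < b < q, q.+1 < b <= q.*2, b == 3 * q | b == (3 * q).+1].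
pose tp b := if P b then q.*2 else q.*2.-1.
pose lo b := if b == q.+1 then q
  else if (b == 1) || (q.+1 < b <= q.*2) then q.+2 else q.+1.
pose hi b := if b == (3 * q).+1 then q.*2.-1 else tp b.
pose u b s := if (b == 1) && (s == q.+2) then q.+1
  else if (b == q.+1) && (s == q) then q.*2
  else if P b && (b != (3 * q).+1) then q.*2.+2 - s else q.*2.+1 - s.
have tpP b : P b /\ tp b = q.*2 \/ ~~ P b /\ tp b = q.*2.-1.
  by rewrite /tp; case: ifP; auto.
have loP b : b = q.+1 /\ lo b = q \/
    (b = 1 \/ q.+1 < b <= q.*2) /\ lo b = q.+2 \/
    (b <> q.+1 /\ b <> 1 /\ ~~ (q.+1 < b <= q.*2)) /\ lo b = q.+1.
  by rewrite /lo; case: eqP => b1; [|case: eqP => b2 /=; [|case: ifP]]; lia.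
have hiP b : b = (3 * q).+1 /\ hi b = q.*2.-1 \/ b <> (3 * q).+1 /\ hi b = tp b.
  by rewrite /hi; case: eqP; auto.
have uP b s : (b = 1 /\ s = q.+2) /\ u b s = q.+1 \/
    (b = q.+1 /\ s = q) /\ u b s = q.*2 \/
    (P b /\ b <> (3 * q).+1 /\ ~ (b = 1 /\ s = q.+2)) /\ u b s = q.*2.+2 - s \/
    ((~~ P b \/ b = (3 * q).+1) /\ ~ (b = q.+1 /\ s = q)) /\ u b s = q.*2.+1 - s.
  by rewrite /u; case: ifP => bs1; [|case: ifP => bs2; [|case: ifP => bs3]]; lia.
have PE b : P b = [|| 0 < b < q, q.+1 < b <= q.*2, b == 3 * q | b == (3 * q).+1].
  by [].
have plan : zigzag_plan n.+1 q.*2 tp lo hi u.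
  move: tp lo hi u tpP loP hiP uP => tp lo hi u tpP loP hiP uP.
  split.
  - by left; lia.
  - by move=> b _; have := tpP b; clear -q2; lia.
  - by clear -nE; lia.
  - move=> _ b bh; have := tpP b; have := tpP (b + q.*2); rewrite !PE.
    by clear -q2 bh; lia.
  - by move=> b _; have := loP b; clear -q2; lia.
  - by move=> b _; case: (hiP b) => -[]; have := tpP b; rewrite PE; clear -q2; lia.
  - move=> b s bn bs.
    (* Each alternative keeps the right edge out of the left-edge range: its span is below [lo] at
       its last point in the first three, and above [hi] in the last. *)
    have bnd : [/\ 2 <= u b s <= q.*2, q.*2 < s + u b s &
      u b s < q \/ u b s = q /\ cyc n.+1 (b + u b s) <> q.+1 \/
      u b s = q.+1 /\ (cyc n.+1 (b + u b s) = 1 \/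
        q.+1 < cyc n.+1 (b + u b s) <= q.*2) \/
      u b s = q.*2 /\ cyc n.+1 (b + u b s) = (3 * q).+1].
      have := cycP n.+1 (b + u b s); move: (cyc n.+1 _) => c cE.
      have := loP b; have := hiP b; have := tpP b; move: bs cE.
      case: (uP b s) => [[[-> ->] ->]|[[[-> ->] ->]|[[Pb ->]|[Pb ->]]]].
      + clear -nE bn q2; move=> *; split; lia.
      + clear -nE bn q2; move=> *; split; lia.
      + move=> bs cE tE hE lE.
        have sle : s <= q.*2 by clear -bs tE hE Pb; lia.
        have sge : q < s by clear -bs lE Pb PE; have := PE b; lia.
        split; [by clear -sle sge; lia|by clear -sle sge q2; lia|].
        case: (ltngtP s q.+1) => [|sq|sq]; first by clear -sge; lia.
          case: (eqVneq s q.+2) => sq2; last by clear -sq sq2 sle; lia.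
          right; left; split; first by clear -sq2; lia.
          by clear -sq2 cE nE bn Pb; lia.
        have b1 : 0 < b < q \/ b = 3 * q.
          by case: Pb => + [b3 _]; rewrite PE; clear -sq bs lE b3; lia.
        right; right; left; split; first by clear -sq; lia.
        by clear -b1 sq cE nE q2; lia.
      + move=> bs cE tE hE lE.
        have hb : hi b = q.*2.-1 by clear -tE hE Pb; lia.
        have Pb' : ~~ (0 < b < q) /\ ~~ (q.+1 < b <= q.*2).
          by case: Pb => + _; rewrite PE; clear -q2; lia.
        have b1 : b <> 1 by clear -Pb' q2; lia.
        have sge : q < s by clear -bs lE Pb Pb' b1; lia.
        split; [by clear -sge hb bs; lia|by clear -hb bs q2; lia|].
        case: (eqVneq s q.+1) => sq; last by left; clear -sq sge q2; lia.
        right; left; split; first by clear -sq; lia.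
        by clear -sq b1 cE nE bn; lia.
    move: bnd; move: (cyc _ _) => c; move: (u b s) => w [w2 w3 w4].
    split=> //; have := loP c; have := hiP c; have := tpP c; rewrite PE; clear -w2 w4 q2; lia.
  - have P1 : P 1 by rewrite PE; clear -q2; lia.
    have Pq : ~~ P q.+1 by rewrite PE; clear -q2; lia.
    move=> b s s' bn bs bs'.
    (* Apart from the rerouted spans, [u b] is a reflection; the rerouted values [q + 1] and [2q]
       exceed all other values at the same label. *)
    have K x : lo b <= x <= hi b -> x <= q.*2 /\
        (b = 1 /\ (x = q.+2 /\ u b x = q.+1 \/
                   q.+2 < x /\ u b x = q.*2.+2 - x) \/
         b = q.+1 /\ (x = q /\ u b x = q.*2 \/ q < x /\ u b x = q.*2.+1 - x) \/
         (P b /\ b <> (3 * q).+1) /\ (b <> 1 /\ b <> q.+1) /\ u b x = q.*2.+2 - x \/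
         (~~ P b \/ b = (3 * q).+1) /\ (b <> 1 /\ b <> q.+1) /\ u b x = q.*2.+1 - x).
      move=> bx; split; first by have := hiP b; have := tpP b; clear -bx; lia.
      case: (eqVneq b 1) => b1.
        have lob : lo b = q.+2 by have := loP b; clear -b1 q2; lia.
        rewrite lob in bx; have := uP b x; rewrite b1 P1 in bx *.
        by clear -bx q2; lia.
      case: (eqVneq b q.+1) => bq.
        have lob : lo b = q by have := loP b; clear -bq q2; lia.
        rewrite lob in bx; have := uP b x; rewrite bq (negPf Pq) in bx *.
        by clear -bx q2; lia.
      right; right; have [b1' bq'] := (elimN eqP b1, elimN eqP bq).
      case: (uP b x) => [[[/b1' []]]|[[[/bq' []]]|[[[Pb [b3 _]] ux]|[[Pb _] ux]]]].
        by left.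
      by right.
    by have := K s bs; have := K s' bs'; clear; lia.
have := zigzag_plan_alpha1 hp plan; apply: leq_trans.
(* Every label gives at least [q] classes, and the labels giving one more number
   [(q - 2) + 1 + 1 = q]. *)
have <- : \sum_(b < n.+1)
    (q + (2 <= b < q) + (3 * q <= b < (3 * q).+1) + (q.+1 <= b < q.+2)) =
    4 * q * q + q.
  rewrite !big_split /= sum_nat_const card_ord !sum_interval ?nE; lia.
apply: leq_sum => -[b bn] _ /=.
have := loP b; have := hiP b; have := tpP b; rewrite PE.
clear -q2; lia.
Qed.

(* The spans s and u add up to 2q + 2, which leaves the edges of span q + 1 to be
   matched among themselves along cycles of odd length, up to three of them. To lose
   only one edge, an edge of span 2q is moved from b = 4q to the zigzag at b = 2q. *)
Lemma alpha1_ge_4q1 (R : realType) (n q : nat) (p : 'I_n.+1 -> 'rV[R]_2) :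
  convex_position p -> n.+1 = (4 * q).+1 -> 0 < q ->
  (4 * q).+1 * q + q.*2 <= alpha1 p.
Proof.
move=> hp nE q1.
(* An edge of span [q + 1] is a left edge where [lo b = q + 1]. Except at [b = 2q] and [b = 4q], its
   partner has span [q + 1] as well and ends where [lo] is [q + 2]. *)
pose lo b := if (q <= b <= q.*2) || (3 * q < b) then q.+1 else q.+2.
pose hi b := if b == 4 * q then q.*2.-1 else q.*2.
pose u b s := if b == 4 * q then q.*2.+1 - s
  else if (b == q.*2) && (s == q.+1) then q.*2 else q.*2.+2 - s.
have loP b : (q <= b <= q.*2 \/ 3 * q < b) /\ lo b = q.+1 \/
    (~~ (q <= b <= q.*2) /\ b <= 3 * q) /\ lo b = q.+2.
  by rewrite /lo; case: ifP; lia.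
have hiP b : b = 4 * q /\ hi b = q.*2.-1 \/ b <> 4 * q /\ hi b = q.*2.
  by rewrite /hi; case: eqP; lia.
have uP b s : b = 4 * q /\ u b s = q.*2.+1 - s \/
    (b = q.*2 /\ s = q.+1) /\ u b s = q.*2 \/
    (b <> 4 * q /\ ~ (b = q.*2 /\ s = q.+1)) /\ u b s = q.*2.+2 - s.
  by rewrite /u; case: eqP => b4; [|case: ifP]; lia.
have plan : zigzag_plan n.+1 q.*2 (fun=> q.*2) lo hi u.
  move: lo hi u loP hiP uP => lo hi u loP hiP uP.
  split=> //.
  - by right; clear -nE; lia.
  - by clear -q1; lia.
  - by clear -nE; lia.
  - by move=> b _; have := loP b; clear -q1; lia.
  - by move=> b _; have := hiP b; clear -q1; lia.
  - move=> b s bn bs.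
    have bnd : [/\ 2 <= u b s <= q.*2, q.*2 < s + u b s &
        u b s <= q \/
        u b s = q.+1 /\ lo (cyc n.+1 (b + u b s)) = q.+2 \/
        u b s = q.*2 /\ hi (cyc n.+1 (b + u b s)) = q.*2.-1].
      have := cycP n.+1 (b + u b s); move: (cyc n.+1 _) => c cE.
      have := loP b; have := hiP b; move: bs cE.
      have := loP c; have := hiP c.
      case: (uP b s) => [[-> ->]|[[[-> ->] ->]|[bs ->]]].
      + by clear -nE bn q1 => *; split; lia.
      + by clear -nE bn q1 => *; split; lia.
      move=> hc lc hs cE hb lb.
      have {}hb : hi b = q.*2 by clear -bs hb; lia.
      have sge : q < s by clear -hs lb; lia.
      split; [by clear -sge hb hs; lia|by clear -sge hb hs; lia|].
      case: (eqVneq s q.+1) => sq; last by left; clear -sge sq; lia.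
      right; left; split; first by clear -sq; lia.
      have bb : q <= b < q.*2 \/ 3 * q < b < 4 * q.
        by clear -bn nE bs sq hs lb; lia.
      by clear -bb cE sq lc nE bn; lia.
    move: bnd; move: (cyc _ _) => c; move: (u b s) => w [w2 w3 w4].
    split=> //; first by case/andP: w2.
    by have := loP c; have := hiP c; clear -w2 w4 q1; lia.
  - move=> b s s' bn bs bs'.
    have K x : lo b <= x <= hi b -> q < x <= q.*2.
      by have := loP b; have := hiP b; clear; lia.
    have := uP b s; have := uP b s'; have := K s bs; have := K s' bs'.
    by clear; lia.
have := zigzag_plan_alpha1 hp plan; apply: leq_trans.
have <- : \sum_(b < n.+1)
    (q + (q <= b < q.*2.+1) + ((3 * q).+1 <= b < 4 * q)) =
    (4 * q).+1 * q + q.*2.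
  rewrite !big_split /= sum_nat_const card_ord !sum_interval ?nE; lia.
apply: leq_sum => -[b bn] _ /=.
have := loP b; have := hiP b.
by clear -q1 nE bn; lia.
Qed.

(** The spans add up to [tp b + 2]. Only span [q + 1] needs care: such edges are left edges for
    [q < b <= 2q] and right edges at all other labels except [2q + 1], so a single short edge stays
    unmatched. *)
Lemma alpha1_ge_4q2 (R : realType) (n q : nat) (p : 'I_n.+1 -> 'rV[R]_2) :
  convex_position p -> n.+1 = (4 * q).+2 -> 0 < q ->
  (4 * q).+2 * q + (3 * q).+1 <= alpha1 p.
Proof.
move=> hp nE q1.
pose tp b := if q.*2 < b then q.*2.+1 else q.*2.
pose lo b := if q < b <= q.*2 then q.+1 else q.+2.
pose u b s := if q.*2 < b then q.*2.+3 - s else q.*2.+2 - s.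
have tpP b : q.*2 < b /\ tp b = q.*2.+1 \/ b <= q.*2 /\ tp b = q.*2.
  by rewrite /tp; case: ltnP; auto.
have loP b : q < b <= q.*2 /\ lo b = q.+1 \/ ~~ (q < b <= q.*2) /\ lo b = q.+2.
  by rewrite /lo; case: ifP; auto.
have uP b s : q.*2 < b /\ u b s = q.*2.+3 - s \/ b <= q.*2 /\ u b s = q.*2.+2 - s.
  by rewrite /u; case: ltnP; auto.
have plan : zigzag_plan n.+1 q.*2.+1 tp lo tp u.
  move: tp lo u tpP loP uP => tp lo u tpP loP uP.
  split=> //.
  - by left; clear -nE; lia.
  - by move=> b _; have := tpP b; clear -q1; lia.
  - by clear -nE; lia.
  - by move=> _ b bh; have := tpP b; have := tpP (b + q.*2.+1); clear -bh; lia.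
  - by move=> b _; have := loP b; clear -q1; lia.
  - move=> b s bn bs.
    have bnd : [/\ 2 <= u b s <= q.+1, q.*2.+1 < s + u b s &
        u b s <= q \/ lo (cyc n.+1 (b + u b s)) = q.+2].
      have := cycP n.+1 (b + u b s); move: (cyc n.+1 _) => c cE.
      have := loP b; have := tpP b; have := uP b s; have := loP c; move: bs cE.
      by clear -nE bn q1 => *; split; lia.
    move: bnd; move: (cyc _ _) => c; move: (u b s) => w [w2 w3 w4].
    split=> //; first by clear -w2 q1; lia.
      by have := tpP c; clear -w2 q1; lia.
    by have := loP c; clear -w2 w4 q1; lia.
  - move=> b s s' bn; have := uP b s; have := uP b s'; have := tpP b.
    by clear; lia.
have := zigzag_plan_alpha1 hp plan; apply: leq_trans.
have <- : \sum_(b < n.+1) (q + (q.+1 <= b < (4 * q).+2)) =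
    (4 * q).+2 * q + (3 * q).+1.
  rewrite !big_split /= sum_nat_const card_ord !sum_interval ?nE; lia.
apply: leq_sum => -[b bn] _ /=.
have := loP b; have := tpP b.
by clear -q1 nE bn; lia.
Qed.

(** At every label the spans [q + 2, ..., 2q + 1] are matched with [q + 1, ..., 2], which uses every
    short edge once. *)
Lemma alpha1_ge_4q3 (R : realType) (n q : nat) (p : 'I_n.+1 -> 'rV[R]_2) :
  convex_position p -> n.+1 = (4 * q).+3 -> (4 * q).+3 * q.+1 <= alpha1 p.
Proof.
move=> hp nE.
have plan : zigzag_plan n.+1 q.*2.+1 (fun=> q.*2.+1) (fun=> q.+2)
    (fun=> q.*2.+1) (fun _ s => q.*2.+3 - s).
  split=> //; try by clear -nE; lia.
  by move=> b s bn bs; split; clear -bs; lia.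
have := zigzag_plan_alpha1 hp plan; apply: leq_trans.
by rewrite sum_nat_const card_ord nE leq_mul2l; lia.
Qed.

(** Covers order 2, the case [q = 0] of residue 2, where the only edge is the only class. *)
Lemma alpha1_ge1 (R : realType) (p : 'I_2 -> 'rV[R]_2) : 1 <= alpha1 p.
Proof.
have e2 : #|[set: 'I_2]| == 2 by rewrite cardsT card_ord.
pose e : edge 2 := exist (fun e : {set 'I_2} => #|e| == 2) _ e2.
rewrite -[X in X <= _]card_unit; apply: (@alpha1_geq _ _ _ unit (fun=> e) (fun=> e)).
- by move=> [] [].
- by move=> [] [].
- by move=> [] [].
- by move=> i; rewrite eqxx.
- by move=> [] [].
Qed.

Theorem theorem5 (R : realType) (n : nat) (p : 'I_n -> 'rV[R]_2)
    (hp : convex_position p) (hn : n <> 4) :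
  (n ^ 2 + n) %/ 4 <= alpha1 p.
Proof.
case: n p hp hn => [|n] p hp hn; first by rewrite div0n.
have := divn_eq n.+1 4; have := ltn_pmod n.+1 (isT : 0 < 4).
move: (n.+1 %/ 4) (n.+1 %% 4) => q r; rewrite mulnC.
case: r => [|[|[|[|//]]]] _ nE.
(* The order is positive and different from 4, which leaves [2 <= q]. *)
- rewrite addn0 in nE; have q2 : 2 <= q by lia.
  apply: leq_trans (alpha1_ge_4q hp nE q2); rewrite nE; nia.
- case: (posnP q) => q0; first by rewrite [X in X <= _](_ : _ = 0) // nE q0.
  rewrite addn1 in nE.
  apply: leq_trans (alpha1_ge_4q1 hp nE q0); rewrite nE; nia.
- case: (posnP q) => q0.
    rewrite q0 in nE; case: nE => n1; move: p hp; rewrite n1 => p hp.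
    exact: alpha1_ge1.
  rewrite addn2 in nE.
  apply: leq_trans (alpha1_ge_4q2 hp nE q0); rewrite nE; nia.
- rewrite addn3 in nE.
  apply: leq_trans (alpha1_ge_4q3 hp nE); rewrite nE; nia.
Qed.
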